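(* Let $f:\mathbb{N}\to\mathbb{N}$ be the shortcut Collatz function, $f(n)=n/2$ if $n$ is even and $f(n)=(3n+1)/2$ if $n$ is odd. For each integer $n\geqslant 3$, let $C_n$ be the $(n-2)\times(n-2)$ matrix with rows and columns indexed by $\{3,\ldots,n\}$ whose $(i,j)$-entry is $1$ if $j=f(i)$ and $0$ otherwise. Then the following two assertions are equivalent: (a) (Aperiodic Collatz conjecture) No nontrivial cyclic trajectory exists; that is, there is no integer $n>2$ such that $f^k(n)\neq 1$ for all $k\in\mathbb{N}$ and such that $f^p(n)=f^q(n)$ for some positive integers $p\neq q$. (b) For every integer $n\geqslant 3$, the matrix $C_n$ is nilpotent.
   Context: $\mathbb{N}=\{1,2,3,\ldots\}$ denotes the positive integers, and $f^k$ denotes the $k$-fold composition of $f$ with itself. The Collatz sequence of $n\in\mathbb{N}$ is $s_0(n)=n$, $s_k(n)=f^k(n)$ for $k>0$. The Collatz sequence of $n$ is called a nontrivial cycle (nontrivial cyclic trajectory) if $n>2$, $s_k(n)\neq 1$ for all $k\in\mathbb{N}$, and the sequence is periodic in the sense that $s_p(n)=s_q(n)$ for some distinct positive integers $p,q$. A square complex matrix $A$ is nilpotent if $A^p=0$ for some positive integer $p$. *)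

(* Defs.v *)
From HB Require Import structures.
From mathcomp Require Import all_boot all_order all_algebra.
From mathcomp Require Import reals.
From mathcomp Require Import complex.
Set Implicit Arguments. Unset Strict Implicit. Unset Printing Implicit Defensive.
Import GRing.Theory.
Local Open Scope ring_scope.

(* The positive integers are the n : nat with 0 < n; collatz
   maps them to themselves (collatz_gt0), so its value at 0 never matters. *)
Definition collatz (n : nat) : nat :=
  if odd n then ((3 * n + 1) %/ 2)%N else (n %/ 2)%N.

Lemma collatz_gt0 (n : nat) : (0 < n)%N -> (0 < collatz n)%N.
Proof.
rewrite /collatz => n0; case: ifP => [_|nodd]; rewrite divn_gt0 //.
  by rewrite addn1 ltnS muln_gt0.
by case: n n0 nodd => [|[]].
Qed.

Definition nontrivial_cycle (n : nat) : Prop :=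
  [/\ (2 < n)%N,
      forall k : nat, (0 < k)%N -> iter k collatz n <> 1%N
    & exists p q : nat, [/\ (0 < p)%N, (0 < q)%N, p <> q &
        iter p collatz n = iter q collatz n]].

(* The matrix C_n: the index i : 'I_(n - 2) stands for the label i + 3, so the
   labels are 3, ..., n. *)
Definition collatz_mx (R : realType) (n : nat) : 'M[R[i]]_(n - 2) :=
  \matrix_(i, j) (if (j + 3 == collatz (i + 3))%N then 1 else 0).

Definition nilpotent_mx (R : realType) (m : nat) (A : 'M[R[i]]_m) : Prop :=
  exists2 p : nat, (0 < p)%N & A ^+ p = 0.

(* Main.v *)
(* Row i of C_n^p is zero unless the first p iterates of i + 3 all stay in
   {3, ..., n}, in which case it is the unit row at the p-th iterate.  So C_n is
   nilpotent iff, for some p, no orbit stays in {3, ..., n} for p steps.  A nontrivial cyclic trajectory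
   is finite and avoids 1 and 2, hence stays in {3, ..., n} for some n;
   conversely an orbit staying in {3, ..., n} for n - 2 steps repeats a value
   by the pigeonhole principle and never leaves {3, ..., n} afterwards. *)
Require Import Defs.
From mathcomp Require Import all_boot all_order all_algebra.
From mathcomp Require Import reals.
From mathcomp Require Import complex zify.

(** Strong induction: an exponent [k >= b] can be replaced by the smaller [k - b + a]. *)
Lemma iter_eventually_periodic {T : Type} {f : T -> T} {x : T} {a b : nat} :
  a < b -> iter a f x = iter b f x ->
  forall k, exists2 l, l < b & iter k f x = iter l f x.
Proof.
move=> ltab eqab; elim/ltn_ind=> k IHk.
have [ltkb|lebk] := ltnP k b; first by exists k.
have [|l ltlb eql] := IHk (k - b + a); first by lia.
by exists l; rewrite // -eql iterD eqab -iterD subnK.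
Qed.

(** Since 2 is sent to 1, an orbit that avoids 1 avoids 2 as well. *)
Lemma iter_collatz_gt2 (n : nat) :
  2 < n -> (forall k, 0 < k -> iter k collatz n <> 1) ->
  forall k, 2 < iter k collatz n.
Proof.
move=> n_gt2 no1 k.
have gt0 : 0 < iter k collatz n.
  elim: k => [|k IHk]; first exact: ltn_trans n_gt2.
  exact: collatz_gt0.
have neq1 : iter k collatz n <> 1.
  by case: k {gt0} => [/= n1|k]; [rewrite n1 in n_gt2 | apply: no1].
have neq2 : iter k collatz n <> 2.
  by move=> eq2; apply: (no1 k.+1) => //; rewrite iterS eq2.
lia.
Qed.

(** Both ends count: the iterates 0 to [p] are tested. Being boolean, it can serve as a 0/1 matrix
    entry. *)
Definition stays_within (n p x : nat) : bool :=
  all (fun k => 2 < iter k collatz x <= n) (iota 0 p.+1).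

Lemma stays_withinP (n p x : nat) :
  reflect (forall k, k <= p -> 2 < iter k collatz x <= n) (stays_within n p x).
Proof.
apply: (iffP allP) => [H k lekp|H k]; first by apply: H; rewrite mem_iota.
by rewrite mem_iota /= add0n ltnS => /H.
Qed.

Lemma stays_withinS (n p x : nat) : 2 < x <= n ->
  stays_within n p.+1 x = stays_within n p (collatz x).
Proof.
move=> x_in; apply/stays_withinP/stays_withinP => H k lekp.
  by rewrite -iterSr; apply: H.
by case: k lekp => // k lekp; rewrite iterSr; apply: H.
Qed.

(** Induction on [p] through [C ^+ p.+1 = C * C ^+ p]: row [i] of [C] has at most one nonzero entry,
    in the column labelled [collatz (i + 3)]. *)
Lemma collatz_mxX (R : realType) (n p : nat) (i j : 'I_(n - 2)) :
  ((collatz_mx R n ^+ p) i j =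
   (stays_within n p (i + 3) && (j + 3 == iter p collatz (i + 3)))%N%:R)%R.
Proof.
have label_in (l : 'I_(n - 2)) : 2 < l + 3 <= n by have := ltn_ord l; lia.
elim: p i => [|p IHp] i.
  rewrite GRing.expr0 mxE /stays_within /= andbT label_in /=.
  by rewrite eqn_add2r eq_sym.
rewrite GRing.exprS mxE stays_withinS // iterSr.
have [fi_in|fi_out] := boolP (2 < collatz (i + 3) <= n).
  have lt_l : collatz (i + 3) - 3 < n - 2 by lia.
  have def_l : Ordinal lt_l + 3 = collatz (i + 3) by rewrite /=; lia.
  rewrite (bigD1 (Ordinal lt_l)) //= big1 => [|l ne_l].
    by rewrite mxE def_l eqxx GRing.mul1r GRing.addr0 IHp def_l.
  rewrite mxE -def_l eqn_add2r.
  have /negPf -> : l != Ordinal lt_l :> nat by [].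
  by rewrite GRing.mul0r.
(* The image is not a label, so row [i] of [C] vanishes. *)
rewrite {1}/stays_within [all _ _]/= (negPf fi_out) /=.
apply: big1 => l _; rewrite mxE ifN ?GRing.mul0r //.
by apply: contra fi_out => /eqP <-.
Qed.

Lemma collatz_mx_nilpotentP (R : realType) (n : nat) :
  nilpotent_mx (collatz_mx R n) <->
  exists2 p, 0 < p & forall x, ~~ stays_within n p x.
Proof.
split=> [[p p_gt0 Ap0]|[p p_gt0 leaves]]; exists p => //.
  move=> x; apply/negP => x_stays.
  have /stays_withinP x_in := x_stays.
  have lt_i : x - 3 < n - 2 by have := x_in 0 isT; rewrite /=; lia.
  have lt_j : iter p collatz x - 3 < n - 2 by have := x_in p (leqnn p); lia.
  (* If [x] stays, this entry of the power is 1, not 0. *)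
  have /eqP := congr1 (fun A : 'M_(n - 2) => A (Ordinal lt_i) (Ordinal lt_j)) Ap0.
  have def_x : x - 3 + 3 = x by have := x_in 0 isT; rewrite /=; lia.
  have def_y : iter p collatz x - 3 + 3 = iter p collatz x.
    by have := x_in p (leqnn p); lia.
  by rewrite collatz_mxX mxE /= def_x def_y x_stays eqxx GRing.oner_eq0.
by apply/matrixP => i j; rewrite collatz_mxX mxE (negPf (leaves _)).
Qed.

Lemma nontrivial_cycle_stays (x : nat) : nontrivial_cycle x ->
  exists2 n, 3 <= n & forall p, stays_within n p x.
Proof.
case=> x_gt2 no1 [p [q [_ _ ne_pq eq_pq]]].
have [b in_first] : exists b, forall k,
    exists2 l, l < b & iter k collatz x = iter l collatz x.
  have [ltpq|ltqp|//] := ltngtP p q.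
    by exists q; apply: iter_eventually_periodic eq_pq.
  by exists p; apply: iter_eventually_periodic (esym eq_pq).
(* The orbit takes only its first [b] values, so their maximum bounds it. *)
pose n := \max_(l < b) iter l collatz x.
have orbit_le k : iter k collatz x <= n.
  have [l ltlb ->] := in_first k.
  exact: (leq_bigmax (F := fun l : 'I_b => iter l collatz x) (Ordinal ltlb)).
exists n; first exact: leq_trans x_gt2 (orbit_le 0).
move=> m; apply/stays_withinP => k _.
by rewrite iter_collatz_gt2 // orbit_le.
Qed.

Lemma stays_nontrivial_cycle (n x : nat) :
  stays_within n (n - 2) x -> nontrivial_cycle x.
Proof.
move/stays_withinP => x_in.
have [a [b [ltab leb eq_ab]]] : exists a b,
    [/\ a < b, b <= n - 2 & iter a collatz x = iter b collatz x].
  (* Pigeonhole: [(n - 2).+1] iterates share [n - 2] labels. *)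
  have lt_g (k : 'I_(n - 2).+1) : iter k collatz x - 3 < n - 2.
    by have := x_in k (leq_ord k); lia.
  pose g k := Ordinal (lt_g k).
  have /injectivePn[a [b ne_ab eq_g]] : ~~ injectiveb g.
    by apply/injectiveP => /leq_card; rewrite !card_ord ltnn.
  have eq_ab : iter a collatz x = iter b collatz x.
    have /= := congr1 val eq_g.
    by have := x_in a (leq_ord a); have := x_in b (leq_ord b); lia.
  have [ltab|ltba|/val_inj eq] := ltngtP a b.
  - by exists a, b; split=> //; apply: leq_ord.
  - by exists b, a; split=> //; apply: leq_ord.
  - by rewrite eq eqxx in ne_ab.
split; first by have := x_in 0 isT; case/andP.
  move=> k _; have [l ltlb ->] := iter_eventually_periodic ltab eq_ab k.
  have := x_in l (ltnW (leq_trans ltlb leb)); lia.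
(* The shift by one makes both exponents positive, as [a] may be 0. *)
by exists a.+1, b.+1; split=> //; [lia | rewrite !iterS eq_ab].
Qed.

Theorem theorem3 (R : realType) :
  (~ exists n : nat, nontrivial_cycle n) <->
  (forall n : nat, (3 <= n)%N -> nilpotent_mx (collatz_mx R n)).
Proof.
split=> [no_cycle n n_ge3|nilp [x /nontrivial_cycle_stays[n n_ge3 x_stays]]].
  apply/collatz_mx_nilpotentP; exists (n - 2); first by rewrite subn_gt0.
  by move=> x; apply/negP => /stays_nontrivial_cycle x_cycle; apply: no_cycle; exists x.
have /collatz_mx_nilpotentP[p _ leaves] := nilp n n_ge3.
by have := leaves x; rewrite x_stays.
Qed.
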